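(* For every positive integer $n$, the set $\mathcal{N}(n)$ has exactly $n!$ elements, i.e. $|\mathcal{N}(n)|=n!$.
   Context: A network on $n$ points is a set $E$ of ordered pairs $(i,j)$ of integers with $1\le i<j\le n$ (the directed edges from $i$ to $j$; at most one edge from $i$ to $j$) such that no point is both the second coordinate of one edge and the first coordinate of another, i.e. there is no triple $i<j<k$ with $(i,j),(j,k)\in E$. (A point which is the first coordinate of some edge is a source, one which is the second coordinate of some edge is a sink, and a point on no edge is neutral.) $\mathcal{N}(n)$ denotes the set of networks on $n$ points satisfying condition (B1): whenever $(i,k),(j,l)\in E$ with $i<j<k<l$, also $(j,k)\in E$. *)

(* Defs.v *)
From mathcomp Require Import all_boot.

Set Implicit Arguments.
Unset Strict Implicit.
Unset Printing Implicit Defensive.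

(* The points 1, ..., n are represented by the elements 0, ..., n-1 of 'I_n. *)
Definition is_network (n : nat) (E : {set 'I_n * 'I_n}) : bool :=
  [forall i, forall j, ((i, j) \in E) ==> (i < j)] &&
  [forall i, forall j, forall k, ~~ (((i, j) \in E) && ((j, k) \in E))].

Definition condB1 (n : nat) (E : {set 'I_n * 'I_n}) : bool :=
  [forall i, forall j, forall k, forall l,
     [&& (i, k) \in E, (j, l) \in E, i < j, j < k & k < l] ==> ((j, k) \in E)].

Definition networks (n : nat) : {set {set 'I_n * 'I_n}} :=
  [set E | is_network E && condB1 E].

(* Main.v *)
Require Import Defs.
From mathcomp Require Import all_boot.

(* Call a point active in a network if a new last point may receive an edge
   from it without breaking the axioms. The networks on n+1 points are the
   networks on n points together with an arbitrary set S of active points (those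
   joined to the new point). If E has a active points, the sum over S of x to the
   number of active points of the extension is x(1+x)^a. Hence
   f_n(x) = sum over E of x^(active points of E) satisfies f_{n+1}(x) = x f_n(x+1),
   so f_n(x) = x(x+1)...(x+n-1), and f_n(1) = n!. *)

(** The first clause says that [j] is no sink; the second is (B1) with the new point as [l]. *)
Definition active n (E : {set 'I_n * 'I_n}) : {set 'I_n} :=
  [set j | [forall i, (i, j) \notin E] &&
     [forall i, forall k, [&& (i, k) \in E, i < j & j < k] ==> ((j, k) \in E)]].

Lemma activeP n (E : {set 'I_n * 'I_n}) j :
  reflect ((forall i, (i, j) \notin E) /\
           (forall i k, (i, k) \in E -> i < j -> j < k -> (j, k) \in E))
          (j \in active n E).
Proof.
rewrite inE; apply: (iffP andP) => [[/forallP sj /forallP aj]|[sj aj]].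
  split=> // i k ik ij jk.
  by have /forallP/(_ k)/implyP := aj i; apply; apply/and3P.
split; first exact/forallP.
by apply/forallP => i; apply/forallP => k; apply/implyP => /and3P[]; apply: aj.
Qed.

Lemma networksP n (E : {set 'I_n * 'I_n}) :
  reflect [/\ forall i j, (i, j) \in E -> i < j,
              forall i j k, (i, j) \in E -> (j, k) \notin E &
              forall i j k l, (i, k) \in E -> (j, l) \in E ->
                i < j -> j < k -> k < l -> (j, k) \in E]
          (E \in networks n).
Proof.
rewrite inE; apply: (iffP andP) => [[/andP[/forallP lt /forallP nt] /forallP b]|].
  split=> [i j|i j k ij|i j k l ik jl ij jk kl].
  - by have /forallP/(_ j)/implyP := lt i.
  - by have /forallP/(_ j)/forallP/(_ k) := nt i; rewrite ij.
  - have /forallP/(_ j)/forallP/(_ k)/forallP/(_ l)/implyP := b i.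
    by apply; apply/and5P.
move=> [lt nt b]; split; first (apply/andP; split).
- by apply/forallP => i; apply/forallP => j; apply/implyP; apply: lt.
- apply/forallP => i; apply/forallP => j; apply/forallP => k.
  by rewrite negb_and -implybE; apply/implyP; apply: nt.
- apply/forallP => i; apply/forallP => j; apply/forallP => k; apply/forallP => l.
  by apply/implyP => /and5P[]; apply: b.
Qed.

(** Old points enter by [lift ord_max], which keeps their values. [None] stands for the new point,
    where no edge can start. *)
Definition extend n (p : {set 'I_n * 'I_n} * {set 'I_n}) :
    {set 'I_n.+1 * 'I_n.+1} :=
  [set q | match unlift ord_max q.1, unlift ord_max q.2 with
           | Some i, Some j => (i, j) \in p.1
           | Some i, None => i \in p.2
           | None, _ => false
           end].

Definition restrict n (E : {set 'I_n.+1 * 'I_n.+1}) :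
    {set 'I_n * 'I_n} * {set 'I_n} :=
  ([set q | (lift ord_max q.1, lift ord_max q.2) \in E],
   [set i | (lift ord_max i, ord_max) \in E]).

Lemma in_extend_lift n (p : {set 'I_n * 'I_n} * {set 'I_n}) i j :
  ((lift ord_max i, lift ord_max j) \in extend n p) = ((i, j) \in p.1).
Proof. by rewrite inE /= !liftK. Qed.

Lemma in_extend_max n (p : {set 'I_n * 'I_n} * {set 'I_n}) i :
  ((lift ord_max i, ord_max) \in extend n p) = (i \in p.2).
Proof. by rewrite inE /= liftK unlift_none. Qed.

Lemma in_extend_from_max n (p : {set 'I_n * 'I_n} * {set 'I_n}) j :
  ((ord_max, j) \in extend n p) = false.
Proof. by rewrite inE /= unlift_none. Qed.

Definition in_extend := (in_extend_lift, in_extend_max, in_extend_from_max).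

Lemma extendK n : cancel (extend n) (restrict n).
Proof.
case=> E S; rewrite /restrict; congr (_, _).
  by apply/setP => -[i j]; rewrite inE in_extend.
by apply/setP => i; rewrite inE in_extend.
Qed.

(** Only edges out of the last point are lost by [restrict], and a network has none because edges
    increase. *)
Lemma restrictK n : {in networks n.+1, cancel (restrict n) (extend n)}.
Proof.
move=> E /networksP[lt _ _]; apply/setP => -[i j].
case: (unliftP ord_max i) => [i'|] ->; last first.
  rewrite in_extend; apply/esym/negP => /lt.
  by rewrite ltnNge -ltnS ltn_ord.
by case: (unliftP ord_max j) => [j'|] ->; rewrite in_extend inE.
Qed.

Lemma lt_lift_max n (i j : 'I_n) : (lift ord_max i < lift ord_max j) = (i < j).
Proof. by rewrite !lift_max. Qed.

Lemma lift_lt_max n (i : 'I_n) : lift ord_max i < @ord_max n.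
Proof. by rewrite lift_max /=. Qed.

Lemma ord_max_lt n (i : 'I_n.+1) : (@ord_max n < i) = false.
Proof. by rewrite ltnNge -ltnS ltn_ord. Qed.

(** An edge to the last point can only serve as the second edge of a path or as the edge $(j,l)$ in
    (B1); these uses are the two clauses of [active]. *)
Lemma extend_networks n (p : {set 'I_n * 'I_n} * {set 'I_n}) :
  (extend n p \in networks n.+1) = (p.1 \in networks n) && (p.2 \subset active n p.1).
Proof.
case: p => E S /=; apply/networksP/andP => [[lt nt b]|[/networksP[lt nt b] /subsetP sS]].
  split.
    apply/networksP; split=> [i j|i j k|i j k l].
    - by have := lt (lift ord_max i) (lift ord_max j); rewrite in_extend lt_lift_max.
    - have := nt (lift ord_max i) (lift ord_max j) (lift ord_max k).
      by rewrite !in_extend.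
    - have := b (lift ord_max i) (lift ord_max j) (lift ord_max k) (lift ord_max l).
      by rewrite !in_extend !lt_lift_max.
  apply/subsetP => j jS; apply/activeP; split=> [i|i k iE].
    have := nt (lift ord_max i) (lift ord_max j) ord_max.
    rewrite !in_extend /= jS => nij.
    by apply/negP => /nij.
  have := b (lift ord_max i) (lift ord_max j) (lift ord_max k) ord_max.
  rewrite !in_extend !lt_lift_max lift_lt_max /= => bE ij jk.
  exact: bE.
split=> [i j|i j k|i j k l].
- case: (unliftP ord_max i) => [i'|] ->; last by rewrite in_extend.
  case: (unliftP ord_max j) => [j'|] ->; rewrite in_extend /=.
    by rewrite lt_lift_max; apply: lt.
  by rewrite lift_lt_max.
- case: (unliftP ord_max j) => [j'|] ->; last by rewrite !in_extend.
  case: (unliftP ord_max i) => [i'|] ->; last by rewrite !in_extend.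
  case: (unliftP ord_max k) => [k'|] ->; rewrite !in_extend /=; first exact: nt.
  by move=> ij; apply/negP => /sS/activeP[nj _]; rewrite (negbTE (nj i')) in ij.
- case: (unliftP ord_max k) => [k'|] ->; last by rewrite ord_max_lt.
  case: (unliftP ord_max i) => [i'|] ->; last by rewrite !in_extend.
  case: (unliftP ord_max j) => [j'|] ->; last by rewrite !in_extend.
  rewrite !lt_lift_max.
  case: (unliftP ord_max l) => [l'|] ->; rewrite !in_extend /= ?lt_lift_max.
    exact: b.
  by move=> ik /sS/activeP[_ aj] ij jk _; apply: aj ik ij jk.
Qed.

(* The points of A still active after a last point joined to S is added; that
   point itself is active exactly when S is empty. *)
Definition surviving {n} (A S : {set 'I_n}) : {set 'I_n} :=
  [set j in A | [forall i in S, (i < j) ==> (j \in S)]].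

Lemma survivingP n (A S : {set 'I_n}) j :
  reflect (j \in A /\ forall i, i \in S -> i < j -> j \in S) (j \in surviving A S).
Proof.
rewrite inE; apply: (iffP andP) => -[jA jS]; split=> //.
  by move=> i iS; have /implyP/(_ iS)/implyP := forallP jS i.
by apply/forall_inP => i iS; apply/implyP; apply: jS.
Qed.

Lemma card_active_extend n (p : {set 'I_n * 'I_n} * {set 'I_n}) :
  #|active n.+1 (extend n p)| = (p.2 == set0) + #|surviving (active n p.1) p.2|.
Proof.
case: p => E S /=.
rewrite -!sum1_card big_mkcond (bigD1_ord ord_max) //=; congr (_ + _).
  (* The new point is a sink unless [S] is empty; the other clause is vacuous, since no point
     exceeds it. *)
  rewrite (_ : (_ \in _) = (S == set0)); first by case: eqP.
  apply/activeP/eqP => [[nS _]|->].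
    by apply/setP => i; have /negbTE := nS (lift ord_max i); rewrite in_extend inE.
  split=> [i|i k _ _]; last by rewrite ord_max_lt.
  by case: (unliftP ord_max i) => [i'|] ->; rewrite in_extend //= inE.
rewrite [RHS]big_mkcond; apply: eq_bigr => j _.
rewrite (_ : (_ \in _) = (j \in surviving (active n E) S)) //.
(* For an old point, the clauses among old points give activity in [E]; taking the new point as [k]
   gives the condition on [S]. *)
apply/activeP/survivingP => [[nS aj]|[/activeP[nS aj] sj]].
  split.
    apply/activeP; split=> [i|i k].
      by have := nS (lift ord_max i); rewrite in_extend.
    by have := aj (lift ord_max i) (lift ord_max k); rewrite !in_extend !lt_lift_max.
  move=> i iS ij; have := aj (lift ord_max i) ord_max.
  by rewrite !in_extend lt_lift_max lift_lt_max /=; apply.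
split=> [i|i k].
  by case: (unliftP ord_max i) => [i'|] ->; rewrite in_extend //=.
case: (unliftP ord_max i) => [i'|] ->; last by rewrite in_extend.
case: (unliftP ord_max k) => [k'|] ->; rewrite !in_extend !lt_lift_max /=.
  exact: aj.
by move=> iS ij _; apply: sj iS ij.
Qed.

Lemma big_subset_split {R : Type} {idx : R} {op : Monoid.com_law idx}
    {T : finType} (A : {set T}) (m : T) (F : {set T} -> R) : m \in A ->
  \big[op/idx]_(S : {set T} | S \subset A) F S =
  op (\big[op/idx]_(S : {set T} | S \subset A :\ m) F (m |: S))
     (\big[op/idx]_(S : {set T} | S \subset A :\ m) F S).
Proof.
move=> mA; rewrite (bigID [pred S : {set T} | m \in S]) /=; congr (op _ _).
  rewrite (reindex_onto (fun S => m |: S) (fun S => S :\ m)) /=; last first.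
    by move=> S /andP[_]; apply: setD1K.
  apply: eq_bigl => S; rewrite setU11 andbT subUset sub1set mA /= subsetD1.
  (* A set [S] containing [m] fails the round trip: removing [m] from [m |: S] does not return
     [S]. *)
  case mS: (m \in S); last by rewrite setU1K ?mS // eqxx.
  rewrite !andbF; apply/negbTE/negP => /andP[_ /eqP/setP/(_ m)].
  by rewrite !inE eqxx mS.
by apply: eq_bigl => S; rewrite subsetD1.
Qed.

(** The binomial theorem, by splitting off one point [m] of [A]: the subsets with [m] contribute $x$
    times as much as those without. *)
Lemma sum_expn_card_subset (T : finType) (x : nat) (A : {set T}) :
  \sum_(S : {set T} | S \subset A) x ^ #|S| = x.+1 ^ #|A|.
Proof.
have [k] := ubnP #|A|; elim: k A => // k IHk A.
have [->|[m mA]] := set_0Vmem A => leAk.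
  by rewrite (eq_bigl (pred1 set0)) ?big_pred1_eq ?cards0 // => S; rewrite subset0.
have cA : #|A| = #|A :\ m|.+1 by rewrite (cardsD1 m A) mA.
have ltk : #|A :\ m| < k by rewrite -ltnS -cA.
rewrite (big_subset_split _ _ _ mA) cA expnS -(IHk (A :\ m)) // mulSn addnC /=.
congr (_ + _); rewrite big_distrr; apply: eq_bigr => S.
by rewrite subsetD1 => /andP[_ mS]; rewrite cardsU1 mS expnS.
Qed.

(* Let m be the least element of A. If m is in S, the survivors are exactly S;
   otherwise m survives and plays no role for the other points. *)
Lemma sum_expn_surviving n (x : nat) (A : {set 'I_n}) :
  \sum_(S : {set 'I_n} | S \subset A) x ^ ((S == set0) + #|surviving A S|) =
  x * x.+1 ^ #|A|.
Proof.
have [k] := ubnP #|A|; elim: k A => // k IHk A.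
have [->|[a aA]] := set_0Vmem A => leAk.
  rewrite (eq_bigl (pred1 set0)) => [|S]; last by rewrite subset0.
  rewrite big_pred1_eq eqxx cards0 (_ : surviving _ _ = set0) ?cards0 ?muln1 //.
  by apply/setP => j; rewrite !inE.
have [m mA minm] : exists2 m : 'I_n, m \in A & forall j : 'I_n, j \in A -> m <= j.
  by have [m] := arg_minnP (fun i : 'I_n => i : nat) aA; exists m.
have cA : #|A| = #|A :\ m|.+1 by rewrite (cardsD1 m A) mA.
have ltk : #|A :\ m| < k by rewrite -ltnS -cA.
(* With $c = |A|-1$, the sets with [m] supply $x(1+x)^c$ and those without supply $x \cdot
   x(1+x)^c$. *)
rewrite (big_subset_split _ _ _ mA) cA expnS mulSn mulnDr /=; congr (_ + _).
  rewrite -sum_expn_card_subset big_distrr; apply: eq_bigr => S sS.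
  have mS : m \notin S by move: sS; rewrite subsetD1 => /andP[].
  rewrite (_ : surviving _ _ = m |: S) ?cardsU1 ?mS.
    rewrite (_ : (_ == _) = false) ?expnS //.
    by apply/negbTE/set0Pn; exists m; rewrite setU11.
  apply/setP => j; apply/survivingP/idP => [[jA]|jS].
    (* A survivor other than [m] lies above the joined point [m], so it must be joined too. *)
    have := minm j jA; rewrite leq_eqVlt => /orP[/eqP/val_inj <-|mj].
      by rewrite setU11.
    by move=> jS; apply: (jS m); rewrite ?setU11.
  split=> //; move: jS; rewrite !inE => /orP[/eqP->//|/(subsetP sS)].
  by rewrite !inE => /andP[].
rewrite -(IHk (A :\ m)) // big_distrr /=; apply: eq_bigr => S sS.
(* The factor $x$ in front is the weight of [m], which survives because nothing in [S] lies below
   it. *)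
rewrite -expnS -addnS; congr (_ ^ (_ + _)).
rewrite (_ : surviving A S = m |: surviving (A :\ m) S) ?cardsU1.
  by rewrite 3!inE eqxx.
apply/setP => j; rewrite in_setU1.
apply/survivingP/orP => [[jA jS]|[/eqP->|/survivingP[]]].
- have [->|njm] := eqVneq j m; first by left.
  by right; apply/survivingP; rewrite !inE njm.
- split=> // i /(subsetP sS); rewrite !inE => /andP[_ iA].
  by rewrite ltnNge minm.
- by rewrite !inE => /andP[_ jA].
Qed.

(** The induction step peels off the factor $x$ and uses the case of $x+1$ for the rest, so [x]
    stays general. *)
Lemma sum_expn_active n (x : nat) :
  \sum_(E in networks n) x ^ #|active n E| = \prod_(i < n) (x + i).
Proof.
elim: n x => [|n IHn] x.
  rewrite big_ord0 (eq_bigl (pred1 set0)) ?big_pred1_eq.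
    by rewrite (eq_card0 (A := active 0 set0)) // => -[].
  move=> E /=; rewrite (_ : E = set0); last by apply/setP => -[[]].
  by rewrite eqxx; apply/networksP; split=> -[].
rewrite big_ord_recl addn0.
under [X in _ = x * X]eq_bigr do rewrite lift0 -addSnnS.
rewrite -IHn (reindex_onto (extend n) (restrict n)) /=; last exact: restrictK.
rewrite big_distrr /=.
(* Each $x(1+x)^a$ is expanded over the sets of active points, so that both sides are sums over the
   same pairs. *)
under [RHS]eq_bigr do rewrite -sum_expn_surviving.
rewrite pair_big_dep /=; apply: eq_big => [p|p _].
  by rewrite extendK eqxx andbT extend_networks.
by rewrite card_active_extend.
Qed.

Theorem theorem2p3 (n : nat) (hn : 0 < n) : #|networks n| = n`!.
Proof.
rewrite -sum1_card fact_prod big_add1 big_mkord.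
(* Factors in the form $1+i$ show $n!$ as the product at $x=1$, where every network has weight 1. *)
under [RHS]eq_bigr do rewrite -add1n.
rewrite -sum_expn_active.
by apply: eq_bigr => E _; rewrite exp1n.
Qed.
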